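(* Let $F$ be a field, $n\ge1$, and let $F^n=Fe_1\oplus\cdots\oplus Fe_n$ be the direct sum of $n$ copies of $F$. For $\lambda\in F$, $$\mathrm{rb}_\lambda(F^n)=\begin{cases}1,&\lambda=0,\\ n,&\lambda\ne0.\end{cases}$$
   Context: $F^n$ is an algebra with $e_i^2=e_i$ and $e_ie_j=0$ for $i\neq j$. For an algebra $A$ over $F$ and $\lambda\in F$, a linear operator $R\colon A\to A$ is a Rota--Baxter operator of weight $\lambda$ if $R(x)R(y)=R(R(x)y+xR(y)+\lambda xy)$ for all $x,y\in A$. The Rota--Baxter $\lambda$-index of $A$ is $$\mathrm{rb}_\lambda(A)=\min\{m\in\mathbb N\mid \text{for every Rota--Baxter operator } R \text{ of weight }\lambda\text{ on }A\text{ there exists } 0\le k\le m \text{ with } R^k(R+\lambda\,\mathrm{id})^{m-k}=0\},$$ and $\mathrm{rb}_\lambda(A)=\infty$ if no such $m$ exists. *)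

(* Defs.v *)
From HB Require Import structures.
From mathcomp Require Import all_boot all_order all_algebra.
From mathcomp Require Import boolp.

Set Implicit Arguments.
Unset Strict Implicit.
Unset Printing Implicit Defensive.

Import GRing.Theory.
Local Open Scope ring_scope.

(* An F-algebra is a left F-module A with a bilinear product mul; neither
   associativity nor a unit is required. *)

Definition rota_baxter (F : fieldType) (A : lmodType F)
    (mul : {bilinear A -> A -> A}) (lambda : F) (R : {linear A -> A}) : Prop :=
  forall x y : A,
    mul (R x) (R y) = R (mul (R x) y + mul x (R y) + lambda *: mul x y).

(* R^k (R + lambda id)^(m - k) = 0 for some k <= m. *)
Definition rb_annihilated (F : fieldType) (A : lmodType F)
    (lambda : F) (R : {linear A -> A}) (m : nat) : Prop :=
  exists2 k : nat, (k <= m)%N &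
    forall x : A, iter k R (iter (m - k) (fun y => R y + lambda *: y) x) = 0.

Definition rb_bound (F : fieldType) (A : lmodType F)
    (mul : {bilinear A -> A -> A}) (lambda : F) (m : nat) : Prop :=
  forall R : {linear A -> A},
    rota_baxter mul lambda R -> rb_annihilated lambda R m.

(* The value None stands for infinity. *)
Definition rb_index (F : fieldType) (A : lmodType F)
    (mul : {bilinear A -> A -> A}) (lambda : F) : option nat :=
  if pselect (exists m : nat, `[< rb_bound mul lambda m >]) is left ex
  then Some (ex_minn ex) else None.

Lemma rb_index_SomeP (F : fieldType) (A : lmodType F)
    (mul : {bilinear A -> A -> A}) (lambda : F) (m : nat) :
  rb_index mul lambda = Some m <->
  rb_bound mul lambda m /\
    (forall m' : nat, rb_bound mul lambda m' -> (m <= m')%N).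
Proof.
rewrite /rb_index; case: pselect => [ex | nex]; last first.
  split=> // -[bm _]; case: nex.
  by exists m; apply/asboolP.
case: ex_minnP => p /asboolP bp minp; split=> [[<-] | [bm minm]].
  by split=> // m' bm'; apply: minp; apply/asboolP.
congr Some; apply/eqP; rewrite eqn_leq (minm p bp) andbT.
by apply: minp; apply/asboolP.
Qed.

Lemma rb_index_NoneP (F : fieldType) (A : lmodType F)
    (mul : {bilinear A -> A -> A}) (lambda : F) :
  rb_index mul lambda = None <-> forall m : nat, ~ rb_bound mul lambda m.
Proof.
rewrite /rb_index; case: pselect => [ex | nex]; split=> //.
  by move=> nb; have [m /asboolP bm] := ex; case: (nb m bm).
by move=> _ m bm; case: nex; exists m; apply/asboolP.
Qed.

(* F^n is the module of row vectors with the entrywise product; the e_i are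
   the delta_mx 0 i. *)
Definition mulFn (F : fieldType) (n : nat) (x y : 'rV[F]_n) : 'rV[F]_n :=
  \row_(i < n) (x 0 i * y 0 i).

Lemma mulFn_is_bilinear (F : fieldType) (n : nat) :
  bilinear_for *:%R *:%R (@mulFn F n).
Proof.
split=> z a x y; apply/rowP=> i; rewrite !mxE.
  by rewrite mulrDl mulrA.
by rewrite mulrDr mulrCA.
Qed.

HB.instance Definition _ (F : fieldType) (n : nat) :=
  bilinear_isBilinear.Build F 'rV[F]_n 'rV[F]_n 'rV[F]_n *:%R *:%R
    (@mulFn F n) (@mulFn_is_bilinear F n).

Lemma mulFn_delta (F : fieldType) (n : nat) (i j : 'I_n) :
  mulFn (delta_mx 0 i) (delta_mx 0 j) =
  if i == j then delta_mx 0 i else 0 :> 'rV[F]_n.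
Proof.
apply/rowP=> l; rewrite !mxE eqxx /=; have [<- | neq] := eqVneq i j.
  by rewrite mxE eqxx /=; case: eqP => _; rewrite ?mulr1 ?mulr0.
rewrite mxE; case: (eqVneq l i) => [-> | _]; last by rewrite mul0r.
by rewrite (negbTE neq) mulr0.
Qed.

(* Main.v *)
From HB Require Import structures.
Require Import Defs.
From mathcomp Require Import all_boot all_order all_algebra.
From mathcomp Require Import boolp ring zify.

(** If [lambda = 0] and [R <> 0], the image of [R] is a nonzero subalgebra of
    [F^n], so it contains an idempotent [e = R x <> 0].  Then [e = 2 R (e x)],
    and as the kernel of [R] is stable under multiplication by [e], this forces
    [R (e x) = 0] and [e = 0].

    If [lambda <> 0], put [G = R + lambda id].  Let [B] be a nonzero subalgebra
    stable under [R], with unit [e].  If [R] and [G] were both bijective on [B],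
    then [G R^-1] would be an automorphism of [B]; it fixes [e = R x], so
    [G x = R x], [x = 0] and [e = 0].  Hence one of [R B] and [G B] has smaller
    dimension than [B], and both are again [R]-stable subalgebras: starting
    from [F^n], at most [n] applications of [R] or [G] give [0].  The bound [n]
    is attained by [(R x)_j = lambda \sum_(i < j) x_i]. *)

Set Implicit Arguments.
Unset Strict Implicit.
Unset Printing Implicit Defensive.

Import GRing.Theory.
Local Open Scope ring_scope.

(** * Subalgebras of F^n: idempotents and units *)

Definition supp_card (F : fieldType) (n : nat) (v : 'rV[F]_n) : nat :=
  #|[pred i | v 0 i != 0]|.

Lemma rV_neq0P (F : fieldType) (n : nat) (v : 'rV[F]_n) :
  v != 0 -> exists i, v 0 i != 0.
Proof.
move=> v0; apply/existsP; apply: contraNT v0 => /existsPn v0.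
by apply/eqP/rowP=> i; rewrite mxE; apply/eqP/negPn/v0.
Qed.

Record subalgebra (F : fieldType) (n : nat) (S : 'rV[F]_n -> Prop) : Prop := {
  subalgebra0 : S 0;
  subalgebraP : forall a x y, S x -> S y -> S (a *: x + y);
  subalgebraM : forall x y, S x -> S y -> S (mulFn x y) }.

(* An element [v] of minimal support satisfies [v * v = v_i *: v]. *)
Lemma subalgebra_idempotent (F : fieldType) (n : nat) (S : 'rV[F]_n -> Prop)
    (v : 'rV[F]_n) :
  subalgebra S -> S v -> v != 0 ->
  exists e, [/\ S e, e != 0 & mulFn e e = e].
Proof.
move=> SA; have [d] := ubnP (supp_card v); elim: d v => // d IHd v ltvd Sv v0.
have [i vi0] := rV_neq0P v0.
(* [w] vanishes at [i] and its support lies inside that of [v], so induction applies unless [w] is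
   0. *)
pose w := - v 0 i *: v + mulFn v v.
have Sw : S w by apply: subalgebraP => //; apply: subalgebraM.
have [w0|/IHd] := eqVneq w 0; last first.
  apply=> //; rewrite ltnS in ltvd; apply: leq_trans ltvd.
  apply: proper_card; apply/properP; split.
    apply/subsetP=> j; rewrite !inE !mxE; apply: contraNneq => ->.
    by rewrite mulr0 mulr0 addr0.
  by exists i; rewrite !inE // !mxE; apply/negPn/eqP; ring.
exists ((v 0 i)^-1 *: v); split.
- rewrite -[_ *: v]addr0; apply: subalgebraP => //; exact: subalgebra0.
- by rewrite scaler_eq0 invr_eq0 negb_or vi0.
apply/rowP=> j; have := congr1 (fun u : 'rV_n => u 0 j) w0.
rewrite !mxE mulNr => /eqP; rewrite addrC subr_eq0 => /eqP vj.
by rewrite mulrACA vj; field.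
Qed.

(* The unit is an idempotent of maximal support. *)
Lemma subalgebra_unit (F : fieldType) (n : nat) (S : 'rV[F]_n -> Prop) :
  subalgebra S -> exists2 e, S e & forall y, S y -> mulFn e y = y.
Proof.
move=> SA.
suff H d e : S e -> mulFn e e = e -> (n - supp_card e < d)%N ->
    exists2 e, S e & forall y, S y -> mulFn e y = y.
  apply: (H _ 0 _ _ (ltnSn _)); first exact: subalgebra0.
  by apply/rowP=> j; rewrite !mxE mulr0.
elim: d e => // d IHd e Se ee lted.
have [U|/existsNP[y /not_implyP[Sy /eqP ney]]] :=
    pselect (forall y, S y -> mulFn e y = y); first by exists e.
(* The annihilator of [e] in [S]. It contains y - e y, which is nonzero, hence an idempotent [f]
   orthogonal to [e]; then e + f is an idempotent of larger support. *)
pose C x := S x /\ mulFn e x = 0.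
have CA : subalgebra C.
  split=> [|a x z [Sx ex] [Sz ez]|x z [Sx ex] [Sz ez]]; split.
  - exact: subalgebra0.
  - by apply/rowP=> j; rewrite !mxE mulr0.
  - exact: subalgebraP.
  - apply/rowP=> j; move: (congr1 (fun u : 'rV_n => u 0 j) ex).
    move: (congr1 (fun u : 'rV_n => u 0 j) ez); rewrite !mxE mulrDr mulrCA.
    by move=> -> ->; rewrite mulr0 addr0.
  - exact: subalgebraM.
  apply/rowP=> j; move: (congr1 (fun u : 'rV_n => u 0 j) ex); rewrite !mxE mulrA.
  by move=> ->; rewrite mul0r.
have eE j : e 0 j * e 0 j = e 0 j.
  by rewrite -{3}ee mxE.
have Cy : C (-1 *: mulFn e y + y).
  split; first by apply: subalgebraP => //; apply: subalgebraM.
  by apply/rowP=> j; rewrite !mxE mulN1r mulrDr mulrN mulrA eE addNr.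
have [|f [[Sf ef] f0 ff]] := subalgebra_idempotent CA Cy.
  by rewrite scaleN1r addrC subr_eq0 eq_sym.
have efE j : e 0 j * f 0 j = 0.
  by have := congr1 (fun u : 'rV_n => u 0 j) ef; rewrite !mxE.
have fE j : f 0 j * f 0 j = f 0 j by rewrite -{3}ff mxE.
apply: (IHd (1 *: e + f)); first exact: subalgebraP.
  apply/rowP=> j; rewrite !mxE mul1r mulrDl !mulrDr eE fE efE mulrC.
  by rewrite efE addr0 add0r.
have lt_supp : (supp_card e < supp_card (1 *: e + f))%N.
  have [i fi] := rV_neq0P f0.
  have ei : e 0 i = 0.
    by have /eqP := efE i; rewrite mulf_eq0 (negPf fi) orbF => /eqP.
  apply: proper_card; apply/properP; split; last first.
    by exists i; rewrite !inE ?mxE ei ?eqxx // mulr0 add0r.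
  apply/subsetP=> j; rewrite !inE !mxE mul1r => ej.
  have /eqP := efE j; rewrite mulf_eq0 (negPf ej) /= => /eqP ->.
  by rewrite addr0.
have : (supp_card (1 *: e + f) <= n)%N.
  by rewrite -[X in (_ <= X)%N](card_ord n) max_card.
by move: lted lt_supp; lia.
Qed.

(** * Weight zero: Rota--Baxter operators vanish *)

Lemma rota_baxter0_eq0 (F : fieldType) (n : nat)
    (R : {linear 'rV[F]_n -> 'rV[F]_n}) :
  rota_baxter (@mulFn F n) 0 R -> forall x, R x = 0.
Proof.
move=> RB v.
have rb x y : mulFn (R x) (R y) = R (mulFn (R x) y + mulFn x (R y)).
  by rewrite (RB x y) scale0r addr0.
apply/eqP; apply: contraT => Rv0.
have IA : subalgebra (fun y => exists x, y = R x).
  split=> [|a _ _ [x ->] [y ->]|_ _ [x ->] [y ->]].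
  - by exists 0; rewrite linear0.
  - by exists (a *: x + y); rewrite linearP.
  by rewrite rb; eexists.
have [|_ [[x ->] e0 ee]] := subalgebra_idempotent IA _ Rv0; first by exists v.
set e := R x in e0 ee *.
have mulC (y z : 'rV[F]_n) : mulFn y z = mulFn z y.
  by apply/rowP=> j; rewrite !mxE mulrC.
have eR2 : e = R (mulFn e x) *+ 2.
  by rewrite -{1}ee rb [mulFn x _]mulC linearD mulr2n.
have ker_stable z : R z = 0 -> R (mulFn e z) = 0.
  move=> Rz; have := rb x z; rewrite Rz.
  have m0 (y : 'rV[F]_n) : mulFn y 0 = 0 by apply/rowP=> j; rewrite !mxE mulr0.
  by rewrite !m0 addr0 => <-.
(* By [eR2], R (2 e x) = e = R x. Nothing is divided by 2, so every characteristic is covered. *)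
have /ker_stable : R (x - mulFn e x *+ 2) = 0.
  by rewrite linearB linearMn -/e -eR2 subrr.
have -> : mulFn e (x - mulFn e x *+ 2) = - mulFn e x.
  apply/rowP=> j; have : e 0 j * e 0 j = e 0 j by rewrite -{3}ee mxE.
  by rewrite !mxE => eE; rewrite mulrBr mulrDr mulrA eE; ring.
rewrite linearN => /eqP; rewrite oppr_eq0 => /eqP Rex.
by rewrite eR2 Rex mul0rn eqxx in e0.
Qed.

(** * Nonzero weight: the upper bound *)

Section NonzeroWeight.

Variables (F : fieldType) (n : nat) (lambda : F).
Variable R : {linear 'rV[F]_n -> 'rV[F]_n}.
Hypothesis lambda0 : lambda != 0.
Hypothesis RB : rota_baxter (@mulFn F n) lambda R.

Let G (y : 'rV[F]_n) := R y + lambda *: y.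
(** The second product attached to [R]: both [R] and [G] are multiplicative from [circ] to the
    entrywise product. *)
Let circ x y := mulFn (R x) y + mulFn x (R y) + lambda *: mulFn x y.
(** [f] and [g] are [R] and [G] as elements of ['End], which gives access to images, kernels and
    dimensions. *)
Let f : 'End('rV[F]_n) := linfun R.
Let g : 'End('rV[F]_n) := linfun R + lambda *: \1%VF.

Let fE x : f x = R x. Proof. exact: lfunE. Qed.
Let gE x : g x = G x.
Proof. by rewrite add_lfunE scale_lfunE id_lfunE fE. Qed.

Let mulRR x y : mulFn (R x) (R y) = R (circ x y). Proof. exact: RB. Qed.

Let mulGG x y : mulFn (G x) (G y) = G (circ x y).
Proof. by rewrite /G -mulRR; apply/rowP=> j; rewrite !mxE; ring. Qed.

Let GR x : G (R x) = R (G x).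
Proof. by rewrite /G linearD linearZ. Qed.

(** Stability under [G] follows, as [G] and [R] differ by a scalar. *)
Definition stable_subalgebra (B : {vspace 'rV[F]_n}) : Prop :=
  {in B &, forall x y, mulFn x y \in B} /\ {in B, forall x, R x \in B}.

Let circ_mem B x y :
  stable_subalgebra B -> x \in B -> y \in B -> circ x y \in B.
Proof. by move=> [BM BR] xB yB; rewrite !rpredD ?rpredZ ?BM ?BR. Qed.

Let G_mem B x : stable_subalgebra B -> x \in B -> G x \in B.
Proof. by move=> [BM BR] xB; rewrite rpredD ?rpredZ ?BR. Qed.

Lemma stable_subalgebra_R B :
  stable_subalgebra B -> stable_subalgebra (f @: B)%VS.
Proof.
move=> SB; split=> [_ _ /memv_imgP[x xB ->] /memv_imgP[y yB ->]|].
  by rewrite !fE mulRR -fE memv_img // circ_mem.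
move=> _ /memv_imgP[x xB ->]; rewrite -[X in X \in _]fE memv_img // fE.
by case: SB => _; apply.
Qed.

Lemma stable_subalgebra_G B :
  stable_subalgebra B -> stable_subalgebra (g @: B)%VS.
Proof.
move=> SB; split=> [_ _ /memv_imgP[x xB ->] /memv_imgP[y yB ->]|].
  by rewrite !gE mulGG -gE memv_img // circ_mem.
move=> _ /memv_imgP[x xB ->]; rewrite gE -GR -gE memv_img //.
by case: SB => _; apply.
Qed.

Lemma dim_img_lt (B : {vspace 'rV[F]_n}) :
  stable_subalgebra B -> B != 0%VS ->
  (\dim (f @: B) < \dim B)%N || (\dim (g @: B) < \dim B)%N.
Proof.
move=> SB B0; apply: contraT; rewrite negb_or -!leqNgt => /andP[lef leg].
have imf : (f @: B = B)%VS.
  apply/eqP; rewrite eqEdim lef andbT; apply/subvP=> _ /memv_imgP[x xB ->].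
  by rewrite fE; case: SB => _; apply.
have img : (g @: B = B)%VS.
  apply/eqP; rewrite eqEdim leg andbT; apply/subvP=> _ /memv_imgP[x xB ->].
  by rewrite gE G_mem.
have injf x : x \in B -> R x = 0 -> x = 0.
  move=> xB Rx; apply/eqP; rewrite -memv0.
  have <- : (B :&: lker f = 0)%VS; last by rewrite memv_cap xB memv_ker fE Rx /=.
  apply/eqP; rewrite -dimv_eq0 -(eqn_add2r (\dim (f @: B))) limg_ker_dim.
  by rewrite imf.
have BA : subalgebra (fun x => x \in B).
  split=> [|a x y xB yB|x y xB yB]; first exact: mem0v.
    by rewrite rpredD ?rpredZ.
  by case: SB => BM _; apply: BM.
have [e eB eU] := subalgebra_unit BA.
have /memv_imgP[x xB] : e \in (f @: B)%VS by rewrite imf.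
rewrite fE => ex.
(* For [y] in [B], R (circ x y) = e (R y) = R y, so circ x y = y by injectivity. Applying [G] shows
   that [G x] is a unit on G B = B, hence equal to [e]. *)
have GxU z : z \in B -> mulFn (G x) z = z.
  rewrite -{1}img => /memv_imgP[y yB ->]; rewrite gE mulGG; congr G.
  apply/eqP; rewrite -subr_eq0; apply/eqP/injf.
    by rewrite rpredB ?circ_mem.
  by rewrite linearB -mulRR -ex eU ?subrr //; case: SB => _; apply.
have Gxe : G x = e.
  rewrite -[LHS]eU ?G_mem //; rewrite -[RHS]GxU //.
  by apply/rowP=> j; rewrite !mxE mulrC.
have x0 : x = 0.
  apply/eqP; move/eqP: Gxe; rewrite /G ex -subr_eq0 addrC addKr.
  by rewrite scaler_eq0 (negPf lambda0).
have [z zB z0] : exists2 z, z \in B & z != 0.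
  by exists (vpick B); rewrite ?memv_pick ?vpick0.
by move: z0; rewrite -(eU z zB) ex x0 linear0;
  case/eqP; apply/rowP=> j; rewrite !mxE mul0r.
Qed.

Lemma rb_annihilated_dim : rb_annihilated lambda R n.
Proof.
(* Invariant after [m] steps: [k] factors [R] and [m - k] factors [G], which commute, send
   everything into a stable subalgebra of dimension at most [n - m]. *)
suff H m : exists2 k, (k <= m)%N &
    exists B, [/\ stable_subalgebra B, (\dim B <= n - m)%N &
      forall x, iter k R (iter (m - k) G x) \in B].
  have [k len [B [_ dB mB]]] := H n; exists k => // x; apply/eqP.
  rewrite -memv0; suff /eqP <- : B == 0%VS by exact: mB.
  by rewrite -dimv_eq0 -leqn0; rewrite subnn in dB.
elim: m => [|m [k km [B [SB dB mB]]]].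
  exists 0%N => //; exists fullv; split=> [||x]; last exact: memvf.
    by split=> [x y _ _|x _]; exact: memvf.
  by rewrite subn0 dimvf dim_matrix mul1r.
have iterRG x : iter k R (G x) = G (iter k R x).
  by elim: (k) => //= j ->; rewrite GR.
have Rm x : iter k.+1 R (iter (m.+1 - k.+1) G x) \in (f @: B)%VS.
  by rewrite subSS /= -fE memv_img.
(* The zero subspace cannot shrink; applying [R] there merely keeps the count. *)
have [B0|B0] := eqVneq B 0%VS.
  exists k.+1 => //; exists (f @: B)%VS; split=> //.
    exact: stable_subalgebra_R.
  by rewrite B0 limg0 dimv0.
have dim_drop d : (d < \dim B)%N -> (d <= n - m.+1)%N.
  by move=> ltd; have := leq_trans ltd dB; rewrite subnS; case: (n - m)%N.
have [lt|lt] := orP (dim_img_lt SB B0).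
  exists k.+1 => //; exists (f @: B)%VS; split=> //.
    exact: stable_subalgebra_R.
  exact: dim_drop.
exists k; first exact: leqW.
exists (g @: B)%VS; split; first exact: stable_subalgebra_G.
  exact: dim_drop.
by move=> x; rewrite subSn //= iterRG -gE memv_img.
Qed.

End NonzeroWeight.

(** * The operator of partial sums, for which the bound is sharp *)

Definition partial_sums (F : fieldType) (n : nat) (lambda : F) (x : 'rV[F]_n) :
    'rV[F]_n :=
  \row_j (lambda * \sum_(i < n | (i < j)%N) x 0 i).

Lemma partial_sums_is_linear (F : fieldType) (n : nat) (lambda : F) :
  linear (@partial_sums F n lambda).
Proof.
move=> a x y; apply/rowP=> j; rewrite !mxE mulrCA -mulrDr; congr (_ * _).
rewrite mulr_sumr -big_split /=; apply: eq_bigr => i _.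
by rewrite !mxE.
Qed.

HB.instance Definition _ (F : fieldType) (n : nat) (lambda : F) :=
  GRing.isLinear.Build F 'rV[F]_n 'rV[F]_n *:%R (@partial_sums F n lambda)
    (@partial_sums_is_linear F n lambda).

(** Pairs of indices are split by which index is larger, or equality. Sequences on [nat] let the
    induction peel off the last term. *)
Lemma sum_mul_sum_lt (F : comPzRingType) (n : nat) (x y : nat -> F) :
  (\sum_(i < n) x i) * (\sum_(i < n) y i) =
  \sum_(i < n) ((\sum_(l < i) x l) * y i + x i * (\sum_(l < i) y l) + x i * y i).
Proof.
elim: n => [|n IHn]; first by rewrite !big_ord0 mulr0.
by rewrite !big_ord_recr /= -IHn; ring.
Qed.

Lemma partial_sums_rota_baxter (F : fieldType) (n : nat) (lambda : F) :
  rota_baxter (@mulFn F n) lambda (@partial_sums F n lambda).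
Proof.
move=> x y; apply/rowP=> j.
(* Extension by 0 to all of [nat], as [sum_mul_sum_lt] requires; only indices below [n] occur in the
   sums. *)
pose ext (z : 'rV[F]_n) l := if insub l is Some i then z 0 i else 0.
have sumE (z : 'rV[F]_n) (k : 'I_n) :
    \sum_(i < n | (i < k)%N) z 0 i = \sum_(i < k) ext z i.
  rewrite (big_ord_widen n (ext z) (ltnW (ltn_ord k))).
  by apply: eq_bigr => i _; rewrite /ext valK.
rewrite !mxE !sumE mulrACA sum_mul_sum_lt -mulrA mulr_sumr; congr (_ * _).
apply: eq_bigr => i _.
have lin : (i < n)%N := ltn_trans (ltn_ord i) (ltn_ord j).
have extE z : ext z i = z 0 (Ordinal lin) by rewrite /ext insubT.
by rewrite !extE !mxE !sumE; ring.
Qed.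

(** For p >= n this forces x = 0. *)
Definition leads_at (F : fieldType) (n : nat) (p : nat) (x : 'rV[F]_n) : Prop :=
  forall j : 'I_n, ((j < p)%N -> x 0 j = 0) /\ (j = p :> nat -> x 0 j != 0).

(** The operator is triangular with [lambda] on the diagonal. *)
Lemma leads_at_shift (F : fieldType) (n p : nat) (lambda : F) (x : 'rV[F]_n) :
  lambda != 0 -> leads_at p x ->
  leads_at p (partial_sums lambda x + lambda *: x).
Proof.
move=> l0 xp j; have s0 : (j <= p)%N -> \sum_(i < n | (i < j)%N) x 0 i = 0.
  by move=> jp; apply: big1 => i ij; apply: (xp i).1; apply: leq_trans jp.
split=> jp; rewrite !mxE s0 ?mulr0 ?add0r.
- by rewrite (xp j).1 ?mulr0.
- exact: ltnW.
- by rewrite mulf_neq0 // (xp j).2.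
by rewrite jp.
Qed.

(** Coordinate p + 1 of the image is lambda x_p, and all earlier ones vanish. *)
Lemma leads_at_partial_sums (F : fieldType) (n p : nat) (lambda : F)
    (x : 'rV[F]_n) :
  lambda != 0 -> leads_at p x -> leads_at p.+1 (partial_sums lambda x).
Proof.
move=> l0 xp j; split=> jp; rewrite mxE.
  rewrite big1 ?mulr0 // => i ij; apply: (xp i).1.
  by apply: leq_trans ij _.
have pn : (p < n)%N by rewrite -ltnS -jp ltnS ltnW.
rewrite mulf_neq0 // (bigD1 (Ordinal pn)) ?jp //= big1 ?addr0.
  exact: (xp _).2.
move=> i /andP[]; rewrite ltnS => ip ne; apply: (xp i).1.
by rewrite ltn_neqAle ip andbT.
Qed.

Theorem proposition1 (F : fieldType) (n : nat) (n_ge1 : (1 <= n)%N)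
    (lambda : F) :
  rb_index (@mulFn F n) lambda = Some (if lambda == 0 then 1%N else n).
Proof.
apply/rb_index_SomeP; have [->|l0] := eqVneq lambda 0.
  split=> [R RB|[|//] b0].
    by exists 1%N => // x; exact: (rota_baxter0_eq0 RB).
  (* A bound m = 0 would make the identity of F^n zero; one Rota--Baxter operator suffices to refute
     it. *)
  have RB : rota_baxter (@mulFn F n) 0 (@partial_sums F n 0).
    exact: partial_sums_rota_baxter.
  have [[|//] _ /(_ (const_mx 1)) /=] := b0 _ RB.
  move/rowP => /(_ (Ordinal n_ge1)); rewrite !mxE => /eqP.
  by rewrite oner_eq0.
split=> [R RB|m bm]; first exact: rb_annihilated_dim.
have [k km /(_ (const_mx 1))] := bm _ (@partial_sums_rota_baxter F n lambda).
set y := iter k _ _ => y0; rewrite leqNgt; apply/negP => ltmn.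
have yk : leads_at k y.
  (* The factors [G] keep the all-ones vector leading at 0, then each [R] moves the lead by one. The
     exponent [m - k] stays fixed in this induction. *)
  rewrite /y; elim: {1 2}(k) => [|j IHj] /=; last exact: leads_at_partial_sums.
  elim: (m - k)%N => [|j IHj] /=; last exact: leads_at_shift.
  by move=> j; split=> // _; rewrite mxE oner_eq0.
have kn := leq_ltn_trans km ltmn.
have := (yk (Ordinal kn)).2 erefl.
by rewrite y0 mxE eqxx.
Qed.
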